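(* Let $\rho_0\in(0,1)$. Then, for any $t\in\left(0,\min\left(\frac{1}{2^{1/\rho_0}},\frac{1}{e^{7/2}}\right)\right]$, the function $\rho\mapsto E_\rho(-t^\rho)$ is monotonically increasing in $\rho\in[\rho_0,1]$.
   Context: $E_\rho(z)=E_{\rho,1}(z)$ denotes the one-parameter Mittag-Leffler function, where $E_{\rho,\mu}(z)=\sum_{k=0}^\infty \frac{z^k}{\Gamma(\rho k+\mu)}$. *)

(* Defs.v *)
From HB Require Import structures.
From mathcomp Require Import all_boot all_order all_algebra.
From mathcomp Require Import all_classical all_reals all_analysis.

Set Implicit Arguments.
Unset Strict Implicit.
Unset Printing Implicit Defensive.

Import Order.TTheory GRing.Theory Num.Theory.
Import numFieldNormedType.Exports.

Local Open Scope classical_set_scope.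
Local Open Scope ring_scope.

(* Euler's integral, meaningful for 0 < s; only such s are used below. *)
Definition Gamma {R : realType} (s : R) : R :=
  \int[lebesgue_measure]_(x in `]0, +oo[) (x `^ (s - 1) * expR (- x)).

(* Restricted to real arguments. As limn is total, this is the sum of the
   power series wherever it converges: for every z when 0 < rho and 0 < mu. *)
Definition mittag_leffler2 {R : realType} (rho mu z : R) : R :=
  limn (series (fun k : nat => z ^+ k / Gamma (rho * k%:R + mu))).

Definition mittag_leffler {R : realType} (rho z : R) : R :=
  mittag_leffler2 rho 1 z.

(* Main.v *)
(** Put f(s) = t^s / Gamma(s + 1), so that E_rho(-t^rho) is the sum of
    (-1)^k f(k rho). For a < b, with c_k = (f(k a) - f(k b)) / k,
      E_b(-t^b) - E_a(-t^a) = sum_(k >= 1) (-1)^(k+1) k c_k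
                            = sum_(m >= 0) (m + 1) (c_(2m+1) - 2 c_(2m+2) + c_(2m+3)).
    As c_k is the integral of F(k s) over s in [a, b], where F = - f', it is enough
    that F be convex. With l = - f' / f one has
      F'' = (l^3 - 3 l l' + l'') f,
    and t <= e^(-7/2) gives l >= 5/2, l' <= 5/3 and l'' >= - 8/3, hence F'' >= f / 4.
    To avoid differentiating Gamma, these estimates are made on the approximants
      t^s N^(-s) prod_(j <= N) (1 + s / j)
    of f, and pass to the limit in the inequality between second differences. *)

Require Import Defs.
From mathcomp Require Import all_boot all_order all_algebra.
From mathcomp Require Import all_classical all_reals all_analysis.
From mathcomp Require Import measurable_realfun ring lra.

Import Order.TTheory GRing.Theory Num.Theory.
Import numFieldNormedType.Exports.

Local Open Scope classical_set_scope.
Local Open Scope ring_scope.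

Section EulerIntegral.
Context {R : realType}.
Local Notation mu := (@lebesgue_measure R).
Implicit Types p q s x c : R.

Lemma powR_le_expR p x : 0 <= p -> 0 <= x ->
  x `^ p <= (2 * (p + 1)) `^ p * expR (x / 2).
Proof.
move=> p0 x0; set c := 2 * (p + 1).
have c0 : 0 < c by rewrite /c; lra.
have xc : x <= c * expR (x / c).
  have /ltW h : x / c < expR (x / c).
    by have := expR_ge1Dx (x / c); lra.
  by rewrite mulrC -ler_pdivrMr.
apply: (@le_trans _ _ ((c * expR (x / c)) `^ p)).
  by apply: ge0_ler_powR => //; rewrite nnegrE// mulr_ge0// ?expR_ge0// ltW.
rewrite powRM ?expR_ge0 ?(ltW c0)// ler_pM2l ?powR_gt0// -expRM ler_expR.
rewrite -mulrA ler_wpM2l// mulrC ler_pdivrMr// /c; lra.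
Qed.

Lemma euler_integrand_le p x : 0 <= p -> 0 <= x ->
  x `^ p * expR (- x) <= (2 * (p + 1)) `^ p * expR (- (x / 2)).
Proof.
move=> p0 x0; rewrite [in leRHS](_ : - (x / 2) = x / 2 - x); last by lra.
by rewrite expRD mulrA ler_pM2r ?expR_gt0// powR_le_expR.
Qed.

Lemma is_derive_expRN2 x :
  is_derive x 1 (fun y : R => - (2 * expR (- (y / 2)))) (expR (- (x / 2))).
Proof.
have -> : (fun y : R => - (2 * expR (- (y / 2)))) =
   (- 2) \*: (expR \o ((- 2^-1) \*: (@idfun R))).
  by apply/funext => y /=; rewrite /GRing.scale/= mulNr; do 3 congr (_ _); lra.
apply: is_derive_eq; rewrite /GRing.scale/= /idfun (_ : - (x / 2) = - 2^-1 * x); last by field.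
by field.
Qed.

Lemma cvg_expRN2 : expR (- (x / 2)) @[x --> +oo] --> (0 : R).
Proof.
apply: (@cvg_comp _ _ _ (fun x : R => x / 2) (fun x => expR (- x)) _ (pinfty_nbhs R)).
  by apply: gt0_cvgMly; rewrite ?invr_gt0.
exact: cvgr_expR.
Qed.

Lemma continuous_expRN2 : continuous (fun x : R => expR (- (x / 2))).
Proof.
move=> x; apply: (@continuous_comp _ _ _ (fun x : R => - (x / 2)) expR).
  by apply: cvgN; apply: cvgM; [exact: cvg_id|exact: cvg_cst].
exact: continuous_expR.
Qed.

Lemma integral_expRN2 :
  (\int[mu]_(x in `]0%R, +oo[) (expR (- (x / 2)))%:E = 2%:E)%E.
Proof.
rewrite integral_itv_obnd_cbnd; last first.
  apply/measurable_EFinP; apply: measurable_funTS.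
  apply: continuous_measurable_fun; exact: continuous_expRN2.
rewrite (@ge0_continuous_FTC2y _ _ (fun y : R => - (2 * expR (- (y / 2)))) _ 0).
- by rewrite mul0r oppr0 expR0 -EFinB; congr EFin; lra.
- by move=> x _; exact: expR_ge0.
- exact/continuous_subspaceT/continuous_expRN2.
- rewrite -[X in _ --> X]oppr0 -[X in _ --> - X](mulr0 2).
  by apply: cvgN; apply: cvgM; [exact: cvg_cst|exact: cvg_expRN2].
- by move=> x _; have [] := is_derive_expRN2 x.
- apply: cvg_at_right_filter; apply: cvgN; apply: cvgM; first exact: cvg_cst.
  exact: continuous_expRN2.
- by move=> x _; rewrite derive1E; have [_ ->] := is_derive_expRN2 x.
Qed.

Lemma integrable_expRN2 :
  mu.-integrable `]0, +oo[ (EFin \o (fun x => expR (- (x / 2)))).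
Proof.
apply/integrableP; split.
  apply/measurable_EFinP; apply: measurable_funTS.
  apply: continuous_measurable_fun; exact: continuous_expRN2.
under eq_integral do rewrite /= ger0_norm ?expR_ge0//.
by rewrite integral_expRN2 ltry.
Qed.

Lemma continuous_expRN : continuous (fun x : R => expR (- x)).
Proof.
move=> x; apply: (@continuous_comp _ _ _ (fun x : R => - x) expR).
  by apply: cvgN; exact: cvg_id.
exact: continuous_expR.
Qed.

Lemma continuous_euler_integrand p : 0 <= p ->
  {within `[0, +oo[, continuous (fun x => x `^ p * expR (- x))}.
Proof.
move=> p0; apply/continuous_within_itvcyP; split.
  move=> x; rewrite in_itv/= andbT => x0; apply: cvgM; last exact: continuous_expRN.
  suff : {for x, continuous (fun y : R => y `^ p)} by [].
  apply/differentiable_continuous/derivable1_diffP/derivable_powR.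
  by rewrite in_itv/= x0.
apply: cvgM; last by apply: cvg_at_right_filter; exact: continuous_expRN.
have [->|pn0] := eqVneq p 0.
  by rewrite powRr0; under eq_fun do rewrite powRr0; exact: cvg_cst.
by rewrite powR0//; apply: powR_cvg0; rewrite lt_neqAle eq_sym pn0.
Qed.

Lemma integrable_euler_integrand p : 0 <= p ->
  mu.-integrable `]0, +oo[ (EFin \o (fun x => x `^ p * expR (- x))).
Proof.
move=> p0.
have mf : measurable_fun (`]0, +oo[ : set R) (fun x => x `^ p * expR (- x)).
  apply: (@measurable_funS _ _ _ _ (`[0, +oo[ : set R)) => //.
    by move=> x /=; rewrite !in_itv/= !andbT; exact: ltW.
  apply: subspace_continuous_measurable_fun => //.
  exact: continuous_euler_integrand.
apply: (le_integrable _ _ _ (integrableZl _ ((2 * (p + 1)) `^ p) integrable_expRN2)) => //.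
  exact/measurable_EFinP.
move=> x /=; rewrite in_itv/= andbT => x0.
rewrite lee_fin !ger0_norm ?mulr_ge0 ?powR_ge0 ?expR_ge0//.
exact/euler_integrand_le/ltW.
Qed.

Lemma GammaE p : Gamma (p + 1) =
  \int[mu]_(x in `]0, +oo[) (x `^ p * expR (- x)).
Proof. by rewrite /Gamma addrK. Qed.

End EulerIntegral.

Section GammaRecurrence.
Context {R : realType}.
Local Notation mu := (@lebesgue_measure R).
Implicit Types p q s x y c : R.

Lemma is_derive_expRN x :
  is_derive x 1 (fun y : R => expR (- y)) (expR (- x) * -1).
Proof.
exact: (@is_derive1_comp R expR -%R x _ _ (is_derive_expR _) (is_deriveNid x 1)).
Qed.

Lemma euler_integrand_cvg0 p : 0 <= p ->
  x `^ p * expR (- x) @[x --> +oo] --> (0 : R).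
Proof.
move=> p0; apply: (@squeeze_cvgr _ _ _ _ (fun=> 0)
    (fun x => (2 * (p + 1)) `^ p * expR (- (x / 2)))).
- near=> x; rewrite mulr_ge0 ?powR_ge0 ?expR_ge0//=.
  by apply: euler_integrand_le => //; near: x; exact: nbhs_pinfty_ge.
- exact: cvg_cst.
- rewrite -[X in _ --> X](mulr0 ((2 * (p + 1)) `^ p)).
  by apply: cvgM; [exact: cvg_cst|exact: cvg_expRN2].
Unshelve. all: by end_near. Qed.

Lemma Gamma1 : Gamma 1 = 1 :> R.
Proof.
have -> : (1 : R) = 0 + 1 by rewrite add0r.
rewrite GammaE Rintegral_itv_obnd_cbnd; last first.
  exact: integrable_euler_integrand.
rewrite (@Rintegral_ge0_continuous_FTC2y _ _ (fun y => - expR (- y)) _ 0).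
- by rewrite oppr0 expR0; lra.
- by move=> x _; rewrite mulr_ge0 ?powR_ge0 ?expR_ge0.
- exact: continuous_euler_integrand.
- by rewrite -[X in _ --> X]oppr0; apply: cvgN; exact: cvgr_expR.
- by move=> x _; have [] := is_deriveN (is_derive_expRN x).
- by apply: cvg_at_right_filter; apply: cvgN; exact: continuous_expRN.
- move=> x _; rewrite derive1E.
  by have [_ ->] := is_deriveN (is_derive_expRN x); rewrite powRr0; ring.
Qed.

(* The derivative of -x^(p+1) e^(-x) changes sign, so it is compensated by a
   multiple of e^(-x/2) to integrate it by the monotone version of the
   fundamental theorem of calculus. *)
Lemma GammaS p : 0 <= p -> Gamma (p + 1 + 1) = (p + 1) * Gamma (p + 1) :> R.
Proof.
move=> p0; rewrite !GammaE.
pose C := (p + 1) * (2 * (p + 1)) `^ p.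
have C0 : 0 <= C by rewrite mulr_ge0 ?powR_ge0//; lra.
have p10 : 0 <= p + 1 by lra.
pose f x := x `^ (p + 1) * expR (- x) - (p + 1) * (x `^ p * expR (- x)) +
   C * expR (- (x / 2)).
have i0 := integrable_euler_integrand p p0.
have i1 := integrable_euler_integrand _ p10.
have i2 := @integrable_expRN2 R.
have i0' : mu.-integrable `]0, +oo[
  (EFin \o (fun x => (p + 1) * (x `^ p * expR (- x)))) by exact: (integrableZl _ (p + 1) i0).
have i2' : mu.-integrable `]0, +oo[
  (EFin \o (fun x => C * expR (- (x / 2)))) by exact: (integrableZl _ C i2).
have i01 : mu.-integrable `]0, +oo[ (EFin \o
  (fun x => x `^ (p + 1) * expR (- x) - (p + 1) * (x `^ p * expR (- x)))).
  exact: (integrableB _ i1 i0').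
have : \int[mu]_(x in `]0, +oo[) f x = 2 * C.
  rewrite Rintegral_itv_obnd_cbnd; last exact: (integrableD _ i01 i2').
  rewrite (@Rintegral_ge0_continuous_FTC2y _ _
    (fun y => - (y `^ (p + 1) * expR (- y)) + C * - (2 * expR (- (y / 2)))) _ 0).
  - by rewrite powR0 ?mul0r ?oppr0 ?expR0; lra.
  - move=> x x0; rewrite /f.
    have h1 : 0 <= x `^ (p + 1) * expR (- x) by rewrite mulr_ge0 ?powR_ge0 ?expR_ge0.
    have := ler_wpM2l p10 (euler_integrand_le p x p0 x0).
    by rewrite [leRHS]mulrA -/C; lra.
  - rewrite /f => x; apply: cvgD.
      apply: cvgB; first exact: continuous_euler_integrand.
      by apply: cvgM; [exact: cvg_cst|exact: continuous_euler_integrand].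
    by apply: cvgM; [exact: cvg_cst|exact/continuous_subspaceT/continuous_expRN2].
  - rewrite [X in _ --> X](_ : 0 = - 0 + C * - (2 * 0)); last by ring.
    apply: cvgD; first by apply: cvgN; exact: euler_integrand_cvg0.
    apply: cvgM; first exact: cvg_cst.
    by apply: cvgN; apply: cvgM; [exact: cvg_cst|exact: cvg_expRN2].
  - move=> x x0; apply: derivableD; last first.
      by apply: derivableM => //; have [] := is_derive_expRN2 x.
    apply: derivableN; apply: derivableM.
      by apply: derivable_powR; rewrite in_itv/= x0.
    by have [] := is_derive_expRN x.
  - apply: cvgD; first apply: cvgN.
      have /continuous_within_itvcyP[_] := continuous_euler_integrand _ p10.
      exact.
    apply: cvg_at_right_filter; apply: cvgM; first exact: cvg_cst.
    apply: cvgN; apply: cvgM; first exact: cvg_cst.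
    exact: continuous_expRN2.
  - move=> x; rewrite in_itv/= andbT => x0; rewrite derive1E.
    have h1 := is_derive1_powR (p + 1) x0.
    have h2 := is_derive_expRN x.
    have h3 := is_deriveD (is_deriveN (is_deriveM h1 h2)) (is_deriveZ C (is_derive_expRN2 x)).
    have [_ E] := h3; rewrite [LHS]E /f /GRing.scale/= addrK; ring.
rewrite RintegralD// RintegralB// !RintegralZl//.
have -> : \int[mu]_(x in `]0, +oo[) expR (- (x / 2)) = 2 :> R.
  by rewrite /Rintegral integral_expRN2.
lra.
Qed.

Lemma Gamma_nat n : Gamma (n%:R + 1) = (n`!)%:R :> R.
Proof.
elim: n => [|n ih]; first by rewrite add0r Gamma1.
by rewrite -natr1 GammaS// ih factS natrM -natr1.
Qed.

Lemma powR_le_affine s y : 0 <= s <= 1 -> 0 < y -> y `^ s <= 1 - s + s * y.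
Proof.
move=> /andP[s0 s1] y0.
have e0 : 0 < y `^ s by rewrite powR_gt0.
rewrite -[leLHS]mul1r -ler_pdivlMr// -powRN.
have -> : (1 - s + s * y) * y `^ (- s) =
    (1 - s) * expR (- s * ln y) + s * expR ((1 - s) * ln y).
  rewrite mulrDl; congr (_ * _ + _); first by rewrite /powR gt_eqF.
  rewrite -mulrA; congr (_ * _).
  by rewrite mulrDl mul1r expRD lnK// /powR gt_eqF.
have h1 := ler_wpM2l _ (expR_ge1Dx (- s * ln y)).
have h2 := ler_wpM2l s0 (expR_ge1Dx ((1 - s) * ln y)).
have {h1}: (1 - s) * (1 + - s * ln y) <= (1 - s) * expR (- s * ln y) by apply: h1; lra.
lra.
Qed.

Lemma Gamma_le_powR p s : 0 <= p -> 0 <= s <= 1 ->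
  Gamma (p + s + 1) <= Gamma (p + 1) * (p + 1) `^ s.
Proof.
move=> p0 s01; have c0 : 0 < p + 1 by lra.
rewrite !GammaE.
pose B := s * (p + 1) `^ s / (p + 1); pose A := (1 - s) * (p + 1) `^ s.
have i0 := integrable_euler_integrand p p0.
have i1 : mu.-integrable `]0, +oo[ (EFin \o (fun x => x `^ (p + 1) * expR (- x))).
  by apply: integrable_euler_integrand; lra.
have i0' : mu.-integrable `]0, +oo[
  (EFin \o (fun x => A * (x `^ p * expR (- x)))) by exact: (integrableZl _ A i0).
have i1' : mu.-integrable `]0, +oo[
  (EFin \o (fun x => B * (x `^ (p + 1) * expR (- x)))) by exact: (integrableZl _ B i1).
apply: (@le_trans _ _ (\int[mu]_(x in `]0, +oo[)
   (A * (x `^ p * expR (- x)) + B * (x `^ (p + 1) * expR (- x))))).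
  apply: le_Rintegral => //.
  - by apply: integrable_euler_integrand; case/andP: s01; lra.
  - exact: (integrableD _ i0' i1').
  move=> x /=; rewrite in_itv/= andbT => x0.
  have xn0 : x != 0 by rewrite gt_eqF.
  rewrite !powRD ?xn0 ?implybT// powRr1 ?(ltW x0)//.
  have -> : x `^ p * x `^ s * expR (- x) = (x `^ p * expR (- x)) * x `^ s by ring.
  have -> : A * (x `^ p * expR (- x)) + B * (x `^ p * x * expR (- x)) =
    (x `^ p * expR (- x)) * (A + B * x) by ring.
  apply: ler_wpM2l; first by rewrite mulr_ge0 ?powR_ge0 ?expR_ge0.
  have xc0 : 0 < x / (p + 1) by rewrite divr_gt0.
  have h := ler_wpM2r (powR_ge0 (p + 1) s) (powR_le_affine s _ s01 xc0).
  rewrite -powRM ?(ltW xc0) ?(ltW c0)// divfK ?gt_eqF// in h.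
  apply: (le_trans h); rewrite le_eqVlt; apply/orP; left; apply/eqP.
  by rewrite /A /B; ring.
rewrite RintegralD// !RintegralZl// -!GammaE GammaS//.
rewrite le_eqVlt; apply/orP; left; apply/eqP; rewrite /A /B; field.
by rewrite gt_eqF.
Qed.

End GammaRecurrence.

Section EulerProduct.
Context {R : realType}.
Implicit Types p s : R.

Lemma Gamma_gt0 s : 0 <= s -> 0 < Gamma (s + 1).
Proof.
move=> s0; have /andP[t1 t2] := truncn_itv s0.
set N := (Num.truncn s).+1 in t2.
have h : Gamma (s + (N%:R - s) + 1) <= Gamma (s + 1) * (s + 1) `^ (N%:R - s).
  apply: Gamma_le_powR => //; apply/andP; split; first lra.
  by rewrite /N -natr1; lra.
have : 0 < Gamma (s + 1) * (s + 1) `^ (N%:R - s).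
  by apply: lt_le_trans h; rewrite subrKC Gamma_nat ltr0n fact_gt0.
by rewrite pmulr_lgt0// powR_gt0//; lra.
Qed.

Lemma Gamma_shift_bounds n s : 0 <= s <= 1 ->
  1 - harmonic n <= Gamma (n.+1%:R + s + 1) / (n.+1`!%:R * n.+1%:R `^ s)
    <= 1 + harmonic n.
Proof.
move=> /andP[s0 s1].
have N0 : 0 < n.+1%:R :> R by rewrite ltr0n.
have F0 : 0 < n.+1`!%:R :> R by rewrite ltr0n fact_gt0.
have P0 : 0 < n.+1%:R `^ s by rewrite powR_gt0.
have D0 : 0 < n.+1`!%:R * n.+1%:R `^ s by rewrite mulr_gt0.
rewrite /harmonic /=; set N := n.+1%:R in N0 P0 D0 *.
apply/andP; split.
  have h := @Gamma_le_powR R (N + s) (1 - s) _ _.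
  have {h}: Gamma (N + s + (1 - s) + 1) <= Gamma (N + s + 1) * (N + s + 1) `^ (1 - s).
    by apply: h; [lra|apply/andP; split; lra].
  have -> : N + s + (1 - s) + 1 = n.+2%:R + 1 by rewrite -(natr1 n.+1) -/N; ring.
  rewrite Gamma_nat => h.
  have h2 : (N + s + 1) `^ (1 - s) <= (N + 2) `^ (1 - s).
    by apply: ge0_ler_powR; rewrite ?nnegrE; lra.
  have h3 : N `^ s <= (N + 2) `^ s.
    by apply: ge0_ler_powR; rewrite ?nnegrE; lra.
  have h4 : (N + 2) `^ (1 - s) * (N + 2) `^ s = N + 2.
    by rewrite -powRD ?subrK ?powRr1//; [lra|rewrite gt_eqF ?implybT//; lra].
  have G0 : 0 < Gamma (N + s + 1) by apply: Gamma_gt0; lra.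
  have h5 : n.+2`!%:R * N `^ s <= Gamma (N + s + 1) * (N + 2).
    rewrite -h4 mulrA; apply: ler_pM => //; first exact: powR_ge0.
    by apply: (le_trans h); rewrite ler_pM2l.
  rewrite factS natrM -(natr1 n.+1) -/N in h5.
  rewrite ler_pdivlMr//.
  have h6 : (N + 1) * (n.+1`!%:R * N `^ s) / (N + 2) <= Gamma (N + s + 1).
    by rewrite ler_pdivrMr; [rewrite mulrA|lra].
  apply: le_trans h6; rewrite mulrAC ler_pM2r//.
  rewrite ler_pdivlMr; last by lra.
  have -> : (1 - N^-1) * (N + 2) = N + 1 - 2 * N^-1 by field; lra.
  by rewrite lerBlDr lerDl mulr_ge0// invr_ge0 ltW.
rewrite ler_pdivrMr//.
have h := @Gamma_le_powR R N s _ _.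
have {h}: Gamma (N + s + 1) <= Gamma (N + 1) * (N + 1) `^ s.
  by apply: h; [lra|rewrite s0 s1].
rewrite Gamma_nat => /le_trans; apply.
rewrite mulrCA ler_pM2l//.
have -> : N + 1 = (1 + N^-1) * N by field; lra.
have i0 : 0 < N^-1 by rewrite invr_gt0.
rewrite powRM ?addr_ge0 ?(ltW i0) ?(ltW N0)// ler_pM2r//.
by rewrite -[leRHS]powRr1; [apply: ler_powR => //; rewrite lerDl ltW|rewrite addr_ge0 ?ltW].
Qed.

Lemma Gamma_shift_cvg s : 0 <= s ->
  (fun n => Gamma (n.+1%:R + s + 1) / (n.+1`!%:R * n.+1%:R `^ s))
    @ \oo --> (1 : R).
Proof.
move=> s0.
suff H m : forall s, 0 <= s <= m.+1%:R ->
    (fun n => Gamma (n.+1%:R + s + 1) / (n.+1`!%:R * n.+1%:R `^ s)) @ \oo --> (1 : R).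
  apply: (H (Num.truncn s)); rewrite s0 /=.
  by have /andP[_ /ltW] := truncn_itv s0.
elim: m => [|m IH] {s0}s /andP[s0 sm].
  apply: (@squeeze_cvgr _ _ _ _ (fun n => 1 - harmonic n) (fun n => 1 + harmonic n)).
  - by apply: nearW => n; apply: Gamma_shift_bounds; rewrite s0 sm.
  - by rewrite -[X in _ --> X]subr0; apply: cvgB; [exact: cvg_cst|exact: cvg_harmonic].
  - by rewrite -[X in _ --> X]addr0; apply: cvgD; [exact: cvg_cst|exact: cvg_harmonic].
have [sm'|ms] := leP s m.+1%:R; first by apply: IH; rewrite s0.
pose u := s - 1.
have u0 : 0 <= u by rewrite /u; have := ler1n R m.+1; rewrite ltn0Sn; lra.
have um : u <= m.+1%:R by rewrite /u; move: sm; rewrite -(natr1 m.+1); lra.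
have cu : (fun n => 1 + (u + 1) * harmonic n) @ \oo --> (1 : R).
  rewrite -[X in _ --> X]addr0 -[X in _ --> _ + X](mulr0 (u + 1)).
  apply: cvgD; first exact: cvg_cst.
  by apply: cvgM; [exact: cvg_cst|exact: cvg_harmonic].
have cIH := IH u; rewrite u0 um in cIH.
rewrite -[X in _ --> X](mulr1 1).
apply: (cvg_trans _ (cvgM (cIH isT) cu)); apply: near_eq_cvg; apply: nearW => n /=.
have -> : s = u + 1 by rewrite /u; ring.
set N : R := n.+1%:R.
have N0 : 0 < N by rewrite ltr0n.
have -> : N + (u + 1) + 1 = N + u + 1 + 1 by ring.
rewrite GammaS; last by lra.
have -> : N `^ (u + 1) = N `^ u * N.
  by rewrite powRD ?powRr1 ?(ltW N0)// (gt_eqF N0) implybT.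

by field; rewrite !gt_eqF ?powR_gt0 ?ltr0n ?fact_gt0.
Qed.

Lemma Gamma_rising n s : 0 <= s ->
  Gamma (n%:R + s + 1) = n`!%:R * Gamma (s + 1) * \prod_(j < n) (1 + s / j.+1%:R).
Proof.
move=> s0; elim: n => [|n ih]; first by rewrite big_ord0 add0r mulr1 mul1r.
have -> : n.+1%:R + s + 1 = n%:R + s + 1 + 1 by rewrite -natr1; ring.
rewrite GammaS; last by have := ler0n R n; lra.
rewrite ih big_ord_recr /= factS natrM -natr1.
by field; have := ler0n R n; lra.
Qed.

Definition euler_product (n : nat) (s : R) : R :=
  n.+1%:R `^ (- s) * \prod_(j < n.+1) (1 + s / j.+1%:R).

Lemma euler_product_cvg s : 0 <= s ->
  euler_product n s @[n --> \oo] --> (Gamma (s + 1))^-1.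
Proof.
move=> s0; have G0 := Gamma_gt0 _ s0.
rewrite -[X in _ --> X]mul1r.
apply: (cvg_trans _ (cvgM (Gamma_shift_cvg _ s0) (cvg_cst _))); apply: near_eq_cvg; apply: nearW => n /=.
rewrite Gamma_rising// /euler_product powRN; field.
by rewrite !gt_eqF ?powR_gt0 ?ltr0n ?fact_gt0.
Qed.

End EulerProduct.

Section SecondDifferences.
Context {R : realType}.
Implicit Types (f df : R -> R) (a b s x u K : R).

Lemma MVT_oo f df a b : a < b ->
  (forall x, a <= x <= b -> is_derive x 1 f (df x)) ->
  exists2 c, a < c < b & f b - f a = df c * (b - a).
Proof.
move=> ab fdf.
have [| |c cab E] := @MVT R f df a b ab; last by exists c => //; rewrite in_itv in cab.
  by move=> x; rewrite in_itv/= => /andP[ax xb]; apply: fdf; rewrite !ltW.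
apply: derivable_within_continuous => x; rewrite in_itv/= => /fdf h.
exact: ex_derive.
Qed.

Lemma second_difference_ge (F F1 F2 : R -> R) m x u : 0 < u ->
  (forall s, x <= s <= x + 2 * u -> is_derive s 1 F (F1 s)) ->
  (forall s, x <= s <= x + 2 * u -> is_derive s 1 F1 (F2 s)) ->
  (forall s, x <= s <= x + 2 * u -> m <= F2 s) ->
  u ^+ 2 * m <= F x - 2 * F (x + u) + F (x + 2 * u).
Proof.
move=> u0 d1 d2 mF2.
pose H := (F \o shift u) - F.
have [||c /andP[xc cx] E] := @MVT_oo H (fun s => F1 (s + u) - F1 s) x (x + u).
- lra.
- move=> s /andP[h1 h2]; apply: is_deriveB; last by apply: d1; apply/andP; split; lra.
  rewrite -[F1 _]mulr1; apply: is_derive1_comp.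
    by apply: d1; rewrite /shift/=; apply/andP; split; lra.
  rewrite -[X in is_derive _ _ _ X]addr0.
  exact: is_deriveD.
have [||d /andP[cd du] E2] := @MVT_oo F1 F2 c (c + u).
- lra.
- by move=> s /andP[h1 h2]; apply: d2; apply/andP; split; lra.
have h : m <= F2 d by apply: mF2; apply/andP; split; lra.
have -> : F x - 2 * F (x + u) + F (x + 2 * u) = H (x + u) - H x.
  rewrite /H !fctE /= (_ : x + 2 * u = x + u + u); last by ring.
  by ring.
rewrite E E2.
have -> : F2 d * (c + u - c) * (x + u - x) = u ^+ 2 * F2 d by ring.
by rewrite ler_wpM2l// sqr_ge0.
Qed.

(* When f is decreasing, this is the integral of - f'(k s) for s in [a, b], so that it
   inherits convexity in k from - f'. *)
Definition mean_drop f a b (k : nat) : R := (f (k%:R * a) - f (k%:R * b)) / k%:R.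

End SecondDifferences.

Section HarmonicBounds.
Context {R : realType}.

Lemma sum_inv_le n : \sum_(j < n.+1) (j.+1%:R : R)^-1 <= 1 + ln n.+1%:R.
Proof.
elim: n => [|n ih]; first by rewrite big_ord1 invr1 ln1 addr0.
rewrite big_ord_recr /=; apply: (le_trans (lerD ih (lexx _))).
rewrite -addrA lerD2l -lerBrDl.
have n2 : 0 < n.+2%:R :> R by rewrite ltr0n.
have i2 : 0 < (n.+2%:R : R)^-1 by rewrite invr_gt0.
have i1 : (n.+2%:R : R)^-1 < 1 by rewrite invf_lt1// ltr1n.
have : ln (1 + - (n.+2%:R : R)^-1) <= - n.+2%:R^-1 by apply: le_ln1Dx; rewrite ltrN2.
have -> : 1 + - (n.+2%:R : R)^-1 = n.+1%:R / n.+2%:R.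
  by rewrite -[n.+1%:R](addrK 1) natr1; field.
rewrite ln_div ?posrE ?ltr0n//.
by rewrite lerNr opprB.
Qed.

(* Both bounds telescope against 1 / (n - 1/2) - 1 / (n + 1/2) >= 1 / n^2. *)
Lemma sum_invX2_le n : \sum_(j < n.+1) (j.+1%:R : R) ^- 2 <= 5 / 3.
Proof.
suff : \sum_(j < n.+1) (j.+1%:R : R) ^- 2 <= 5 / 3 - (n%:R + 3 / 2)^-1.
  have : 0 < (n%:R + 3 / 2 : R)^-1 by rewrite invr_gt0; move: (ler0n R n); move: n%:R => x; lra.
  lra.
elim: n => [|n ih]; first by rewrite big_ord1 expr1n invr1 add0r invf_div; lra.
rewrite big_ord_recr /= -[n.+2%:R]natr1 -[n.+1%:R]natr1; have := ler0n R n; move: ih.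
move: (\sum_(_ < _) _) (n%:R) => S x ih x0.
have : (x + 1 + 1) ^- 2 <= (x + 3 / 2)^-1 - (x + 1 + 3 / 2)^-1 :> R.
  have -> : (x + 3 / 2)^-1 - (x + 1 + 3 / 2)^-1 = ((x + 3 / 2) * (x + 1 + 3 / 2))^-1.
    by field; rewrite !gt_eqF; lra.
  by rewrite lef_pV2 ?posrE; nra.
move: ih; move: (_ ^- _) (x + 3 / 2)^-1 (x + 1 + 3 / 2)^-1 => u v w; lra.
Qed.

Lemma sum_invX3_le n : \sum_(j < n.+1) (j.+1%:R : R) ^- 3 <= 4 / 3.
Proof.
suff : \sum_(j < n.+1) (j.+1%:R : R) ^- 3 <= 4 / 3 - 2^-1 * (n%:R + 3 / 2)^-1.
  have : 0 < (n%:R + 3 / 2 : R)^-1 by rewrite invr_gt0; move: (ler0n R n); move: n%:R => x; lra.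
  lra.
elim: n => [|n ih]; first by rewrite big_ord1 expr1n invr1 add0r invf_div; lra.
rewrite big_ord_recr /= -[n.+2%:R]natr1 -[n.+1%:R]natr1; have := ler0n R n; move: ih.
move: (\sum_(_ < _) _) (n%:R) => S x ih x0.
have : (x + 1 + 1) ^- 3 <= 2^-1 * ((x + 3 / 2)^-1 - (x + 1 + 3 / 2)^-1) :> R.
  have -> : 2^-1 * ((x + 3 / 2)^-1 - (x + 1 + 3 / 2)^-1) =
      (2 * ((x + 3 / 2) * (x + 1 + 3 / 2)))^-1.
    by field; rewrite !gt_eqF; lra.
  by rewrite lef_pV2 ?posrE; nra.
move: ih; move: (_ ^- _) (x + 3 / 2)^-1 (x + 1 + 3 / 2)^-1 => u v w; lra.
Qed.

Lemma prod_derive n (s : R) : 0 <= s ->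
  is_derive s 1 (fun x => \prod_(j < n) (1 + x / j.+1%:R))
    ((\sum_(j < n) (s + j.+1%:R)^-1) * \prod_(j < n) (1 + s / j.+1%:R)).
Proof.
move=> s0; elim: n => [|n ih].
  under eq_fun do rewrite big_ord0; rewrite !big_ord0 mul0r; exact: is_derive_cst.
under eq_fun do rewrite big_ord_recr /=.
have h : is_derive s 1 (fun x : R => 1 + x / n.+1%:R) n.+1%:R^-1.
  have -> : (fun x : R => 1 + x / n.+1%:R) = cst 1 + n.+1%:R^-1 \*: (@idfun R).
    by apply/funext => x; rewrite !fctE /= /GRing.scale/= mulrC.
  rewrite -[X in is_derive _ _ _ X]add0r -[X in is_derive _ _ _ (_ + X)]mulr1.
  exact: is_deriveD.
apply: (is_derive_eq (is_deriveM ih h)); rewrite /GRing.scale/=.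
rewrite !big_ord_recr /=; field.
by move: (ler0n R n); move: n%:R => x x0; rewrite !gt_eqF; lra.
Qed.

End HarmonicBounds.

Section EulerProductDerivatives.
Context {R : realType}.
Variables (K : R) (n : nat).
Implicit Types s x u : R.

Definition exp_prod s : R := expR (- (K * s)) * \prod_(j < n) (1 + s / j.+1%:R).

Definition inv_sum m s : R := \sum_(j < n) (s + j.+1%:R) ^- m.

Lemma inv_sum_derive m s : 0 <= s ->
  is_derive s 1 (inv_sum m.+1) (- (m.+1%:R * inv_sum m.+2 s)).
Proof.
move=> s0.
have -> : inv_sum m.+1 = \sum_(j < n) (fun s : R => (s + j.+1%:R) ^- m.+1).
  by apply/funext => x; rewrite fct_sumE.
rewrite mulr_sumr -sumrN; apply: is_derive_sum => j.
have p0 : s + j.+1%:R != 0 by have j0 := ltr0Sn R j; rewrite gt_eqF//; lra.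
have h : is_derive s 1 (fun x : R => x + j.+1%:R) 1.
  by rewrite -[X in is_derive _ _ _ X]addr0; apply: is_deriveD.
have h1 := is_deriveX m.+1 h.
have e : (fun x : R => x + j.+1%:R) ^+ m.+1 = (fun x => (x + j.+1%:R) ^+ m.+1).
  by apply/funext => x; rewrite exprfctE.
rewrite e in h1.
apply: (is_derive_eq (is_deriveV _ h1)); first by rewrite expf_neq0.
rewrite /GRing.scale/= !exprS.
set y := s + _ in p0 *; have : y ^+ m != 0 by rewrite expf_neq0.
by move: (y ^+ m) => z z0; field; rewrite z0 p0.
Qed.

Lemma exp_prod_derive s : 0 <= s ->
  is_derive s 1 exp_prod (- ((K - inv_sum 1 s) * exp_prod s)).
Proof.
move=> s0.
have hl : is_derive s 1 (fun x : R => - (K * x)) (- K).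
  have h := is_deriveN (is_deriveZ K (is_derive_id s 1)).
  by apply: (is_derive_eq h); rewrite /GRing.scale/= mulr1.
have he := @is_derive1_comp R expR (fun x => - (K * x)) s _ _ (is_derive_expR _) hl.
apply: (is_derive_eq (is_deriveM he (prod_derive n s s0))).
by rewrite /GRing.scale/= /exp_prod /inv_sum; ring.
Qed.

Lemma exp_prod_gt0 s : 0 <= s -> 0 < exp_prod s.
Proof.
move=> s0; rewrite mulr_gt0 ?expR_gt0// prodr_gt0// => j _.
by rewrite ltr_wpDr// divr_ge0.
Qed.

Lemma inv_sum_le m s : 0 <= s -> inv_sum m s <= inv_sum m 0.
Proof.
move=> s0; apply: ler_sum => j _.
have j0 := ltr0Sn R j.
by rewrite add0r lef_pV2 ?posrE ?exprn_gt0 ?lerXn2r ?nnegrE//; lra.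
Qed.

Hypothesis n0 : (0 < n)%N.

Lemma inv_sum0E m : inv_sum m 0 = \sum_(j < n.-1.+1) j.+1%:R ^- m.
Proof. by rewrite /inv_sum prednK//; apply: eq_bigr => j _; rewrite add0r. Qed.

Lemma inv_sum1_le : inv_sum 1 0 <= 1 + ln n%:R.
Proof. by have := @sum_inv_le R n.-1; rewrite inv_sum0E prednK. Qed.

Lemma inv_sum2_le : inv_sum 2 0 <= 5 / 3.
Proof. by rewrite inv_sum0E sum_invX2_le. Qed.

Lemma inv_sum3_le : inv_sum 3 0 <= 4 / 3.
Proof. by rewrite inv_sum0E sum_invX3_le. Qed.

Hypothesis hK : 7 / 2 + ln n%:R <= K.

(* F = - exp_prod', F1 = F' and F2 = F''. *)
Let F s := (K - inv_sum 1 s) * exp_prod s.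
Let F1 s := (inv_sum 2 s - (K - inv_sum 1 s) ^+ 2) * exp_prod s.
Let F2 s := ((K - inv_sum 1 s) ^+ 3 - 3 * (K - inv_sum 1 s) * inv_sum 2 s -
  2 * inv_sum 3 s) * exp_prod s.

Let lam_ge s : 0 <= s -> 5 / 2 <= K - inv_sum 1 s.
Proof.
move=> /(inv_sum_le 1); have := inv_sum1_le; move: hK.
by move: (inv_sum 1 s) (inv_sum 1 0) (ln _) => x y z; lra.
Qed.

Lemma exp_prod_le s x : 0 <= s -> s <= x -> exp_prod x <= exp_prod s.
Proof.
move=> s0; rewrite le_eqVlt => /predU1P[->//|sx].
have [||c /andP[sc cx]] := @MVT_oo R exp_prod (fun s => - F s) s x => //.
  by move=> y /andP[y1 y2]; apply: exp_prod_derive; exact: le_trans y1.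
have h : 0 <= F c * (x - s).
  have c0 : 0 <= c by lra.
  apply: mulr_ge0; last by rewrite subr_ge0 ltW.
  apply: mulr_ge0; last exact/ltW/exp_prod_gt0.
  by apply: le_trans (lam_ge c c0); lra.
by move=> E; rewrite -subr_le0 E mulNr oppr_le0.
Qed.

Lemma exp_prod_slope_derive s : 0 <= s -> is_derive s 1 F (F1 s).
Proof.
move=> s0.
have h1 := is_deriveB (is_derive_cst K s 1) (inv_sum_derive 0 s s0).
have h2 := is_deriveM h1 (exp_prod_derive s s0).
apply: (is_derive_eq h2); rewrite /GRing.scale/= /F1 !fctE; ring.
Qed.

Lemma exp_prod_slope_derive2 s : 0 <= s -> is_derive s 1 F1 (F2 s).
Proof.
move=> s0.
have h1 := is_deriveB (is_derive_cst K s 1) (inv_sum_derive 0 s s0).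
have h2 := is_deriveB (inv_sum_derive 1 s s0) (is_deriveX 2 h1).
have h3 := is_deriveM h2 (exp_prod_derive s s0).
apply: (is_derive_eq h3); rewrite /GRing.scale/= /F2 !fctE; ring.
Qed.

Lemma exp_prod_slope_derive2_ge s : 0 <= s -> 4^-1 * exp_prod s <= F2 s.
Proof.
move=> s0; rewrite /F2 ler_pM2r ?exp_prod_gt0//.
have := inv_sum_le 2 s s0; have := inv_sum_le 3 s s0.
have := inv_sum2_le; have := inv_sum3_le; have := lam_ge s s0.
set l := K - _; set a := inv_sum 2 s; set b := inv_sum 3 s => l0 ? ? ? ?.
have h : 0 <= l * (l ^+ 2 - 3 * a - 5 / 4) by rewrite mulr_ge0//; [lra|nra].
have -> : l ^+ 3 - 3 * l * a - 2 * b =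
  l * (l ^+ 2 - 3 * a - 5 / 4) + 5 / 4 * l - 2 * b by ring.
lra.
Qed.

Lemma exp_prod_slope_second_difference x u : 0 <= x -> 0 < u ->
  u ^+ 2 * (4^-1 * exp_prod (x + 2 * u)) <= F x - 2 * F (x + u) + F (x + 2 * u).
Proof.
move=> x0 u0; apply: (second_difference_ge F F1 F2) => // s /andP[s1 s2].
- by apply: exp_prod_slope_derive; lra.
- by apply: exp_prod_slope_derive2; lra.
- have s0 : 0 <= s by lra.
  by apply: le_trans (exp_prod_slope_derive2_ge s s0); rewrite ler_pM2l// exp_prod_le.
Qed.

Lemma exp_prod_second_difference k (a b : R) : 0 < a -> a < b ->
  a ^+ 2 * (4^-1 * exp_prod (k.+3%:R * b)) * (b - a) <=
    mean_drop exp_prod a b k.+1 - 2 * mean_drop exp_prod a b k.+2 +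
      mean_drop exp_prod a b k.+3.
Proof.
move=> a0 ab.
pose h j := (j%:R^-1 : R) \*: (exp_prod \o (fun s : R => j%:R * s)).
have dh j s : 0 < s -> is_derive s 1 (h j.+1) (- F (j.+1%:R * s)).
  move=> s0.
  have d1 : is_derive s 1 (fun s : R => j.+1%:R * s) j.+1%:R.
    by rewrite -[X in is_derive _ _ _ X]mulr1; apply: is_deriveZ.
  have j0 : 0 <= j.+1%:R * s by rewrite mulr_ge0// ltW.
  have d2 := is_deriveZ (j.+1%:R^-1) (is_derive1_comp (exp_prod_derive _ j0) d1).
  apply: (is_derive_eq d2); rewrite /GRing.scale/= /F.
  by field.
pose G := h k.+1 - 2 \*: h k.+2 + h k.+3.
have [|s /andP[as_ sb] E] := @MVT_oo R G (fun s =>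
    - F (k.+1%:R * s) - 2 * - F (k.+2%:R * s) + - F (k.+3%:R * s)) a b ab.
  move=> s /andP[as_ _]; have s0 : 0 < s by lra.
  apply: is_deriveD; last exact: dh.
  by apply: is_deriveB; [exact: dh|apply: is_deriveZ; exact: dh].
have -> : mean_drop exp_prod a b k.+1 - 2 * mean_drop exp_prod a b k.+2 +
    mean_drop exp_prod a b k.+3 = - (G b - G a).
  by rewrite /mean_drop /G /h !fctE /= /GRing.scale/=; ring.
rewrite E -mulNr ler_pM2r ?subr_gt0//.
have s0 : 0 < s by lra.
have j0 : 0 <= k.+1%:R * s by rewrite mulr_ge0// ltW.
have e2 : k.+1%:R * s + s = k.+2%:R * s by rewrite -[k.+2%:R]natr1; ring.
have e3 : k.+1%:R * s + 2 * s = k.+3%:R * s.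
  by rewrite -[k.+3%:R]natr1 -[k.+2%:R]natr1; ring.
have := exp_prod_slope_second_difference _ s j0 s0; rewrite e2 e3 => H.
have -> : - (- F (k.+1%:R * s) - 2 * - F (k.+2%:R * s) + - F (k.+3%:R * s)) =
  F (k.+1%:R * s) - 2 * F (k.+2%:R * s) + F (k.+3%:R * s) by ring.
apply: le_trans H; apply: ler_pM.
- exact: sqr_ge0.
- by rewrite mulr_ge0// ltW// exp_prod_gt0// mulr_ge0//; lra.
- by rewrite lerXn2r ?nnegrE; lra.
- by rewrite ler_pM2l// exp_prod_le// ?mulr_ge0 ?ler_wpM2l ?ltW.
Qed.

End EulerProductDerivatives.

Section Comparison.
Context {R : realType}.
Implicit Types (a b s t : R).

Definition ml_term t s : R := t `^ s / Gamma (s + 1).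

Lemma mittag_leffler_ml_term t rho :
  mittag_leffler rho (- t `^ rho) =
    limn (series (fun k => (-1) ^+ k * ml_term t (k%:R * rho))).
Proof.
rewrite /mittag_leffler /mittag_leffler2; congr (limn (series _)).
apply/funext => k; rewrite /ml_term (exprNn (t `^ rho)) -mulrA.
by rewrite -(powR_mulrn k (powR_ge0 t rho)) -powRrM (mulrC rho).
Qed.

Lemma exp_prodE t n s : 0 < t ->
  exp_prod (ln n.+1%:R - ln t) n.+1 s = t `^ s * euler_product n s.
Proof.
move=> t0; rewrite /exp_prod /euler_product mulrA; congr (_ * _).
rewrite /powR !gt_eqF ?ltr0n// -expRD; congr expR; ring.
Qed.

Lemma exp_prod_cvg t s : 0 < t -> 0 <= s ->
  exp_prod (ln n.+1%:R - ln t) n.+1 s @[n --> \oo] --> ml_term t s.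
Proof.
move=> t0 s0; under eq_fun do rewrite exp_prodE//.
by apply: cvgM; [exact: cvg_cst|exact: euler_product_cvg].
Qed.

Lemma ml_term_gt0 t s : 0 < t -> 0 <= s -> 0 < ml_term t s.
Proof. by move=> t0 s0; rewrite divr_gt0 ?powR_gt0 ?Gamma_gt0. Qed.

Section SmallTime.
Variable t : R.
Hypotheses (t0 : 0 < t) (lnt : ln t <= - (7 / 2)).

Lemma ml_term_le s : 0 <= s -> ml_term t s <= expR (- s).
Proof.
move=> s0; apply: (ler_cvg_to (exp_prod_cvg t s t0 s0) (cvg_cst (expR (- s)))).
apply: nearW => n; rewrite /exp_prod.
have h : \prod_(j < n.+1) (1 + s / j.+1%:R) <= expR (s * (1 + ln n.+1%:R)).
  apply: (@le_trans _ _ (\prod_(j < n.+1) expR (s / j.+1%:R))).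
    apply: ler_prod => j _; rewrite expR_ge1Dx andbT.
    by rewrite addr_ge0// divr_ge0.
  rewrite -expR_sum ler_expR -mulr_sumr ler_wpM2l//.
  exact: sum_inv_le.
apply: (le_trans (ler_wpM2l (expR_ge0 _) h)).
rewrite -expRD ler_expR -subr_ge0.
set l := ln _; have -> : - s - (- ((l - ln t) * s) + s * (1 + l)) =
  s * (- ln t - 2) by ring.
by rewrite mulr_ge0//; move: lnt; move: (ln t) => x; lra.
Qed.

Lemma ml_term_second_difference a b k : 0 < a -> a < b ->
  a ^+ 2 * (4^-1 * ml_term t (k.+3%:R * b)) * (b - a) <=
    mean_drop (ml_term t) a b k.+1 - 2 * mean_drop (ml_term t) a b k.+2 +
      mean_drop (ml_term t) a b k.+3.
Proof.
move=> a0 ab.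
pose e n := exp_prod (ln n.+1%:R - ln t) n.+1.
have ce s : 0 <= s -> e n s @[n --> \oo] --> ml_term t s by exact: exp_prod_cvg.
have cd j : mean_drop (e n) a b j @[n --> \oo] --> mean_drop (ml_term t) a b j.
  apply: cvgM; last exact: cvg_cst.
  by apply: cvgB; apply: ce; rewrite mulr_ge0//; lra.
apply: (@ler_cvg_to _ \oo _ R
  (fun n => a ^+ 2 * (4^-1 * e n (k.+3%:R * b)) * (b - a))
  (fun n => mean_drop (e n) a b k.+1 - 2 * mean_drop (e n) a b k.+2 +
      mean_drop (e n) a b k.+3)).
- apply: cvgM; last exact: cvg_cst.
  apply: cvgM; first exact: cvg_cst.
  apply: cvgM; first exact: cvg_cst.
  by apply: ce; rewrite mulr_ge0//; lra.
- apply: cvgD; last exact: cd.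
  apply: cvgB; first exact: cd.
  by apply: cvgM; [exact: cvg_cst|exact: cd].
- apply: nearW => n; apply: exp_prod_second_difference => //.
  by rewrite addrC lerD2l lerNr.
Qed.

Lemma is_cvg_series_ml_term a : 0 < a ->
  cvgn (series (fun k => (-1) ^+ k * ml_term t (k%:R * a))).
Proof.
move=> a0; apply: normed_cvg.
apply: (@series_le_cvg _ _ (geometric 1 (expR (- a)))).
- by move=> n; exact: normr_ge0.
- by move=> n; rewrite /= mul1r exprn_ge0// expR_ge0.
- move=> n /=; have na0 : 0 <= n%:R * a by rewrite mulr_ge0// ltW.
  rewrite normrM normrX normrN1 expr1n mul1r mul1r.
  rewrite ger0_norm; last exact/ltW/ml_term_gt0.
  by rewrite (le_trans (ml_term_le _ na0))// -mulrN expRM_natl.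
- apply: is_cvg_geometric_series.
  by rewrite ger0_norm ?expR_ge0// expR_lt1 oppr_lt0.
Qed.

End SmallTime.

(* Summation by parts, twice: the iterated partial sums of the coefficients
   1, -2, 3, -4, ... are 1, 0, 2, 0, 3, 0, ... and in particular nonnegative. *)
Lemma alternating_sum_second_difference (c : nat -> R) m :
  \sum_(0 <= k < m.*2.+1) (-1) ^+ k.+1 * (k%:R * c k) =
  \sum_(i < m) i.+1%:R * (c i.*2.+1 - 2 * c i.*2.+2 + c i.*2.+3) - m%:R * c m.*2.+1.
Proof.
elim: m => [|m ih].
  by rewrite big_nat1 big_ord0 !mul0r mulr0 subr0.
rewrite doubleS big_nat_recr// big_nat_recr// ih big_ord_recr /=.
have e : (-1) ^+ m.*2 = 1 :> R by rewrite -signr_odd odd_double.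
rewrite !exprS e -!natr1 -mul2n natrM; ring.
Qed.

Lemma mittag_leffler_lt t a b : 0 < t -> ln t <= - (7 / 2) -> 0 < a -> a < b ->
  mittag_leffler a (- t `^ a) < mittag_leffler b (- t `^ b).
Proof.
move=> t0 lnt a0 ab; rewrite !mittag_leffler_ml_term.
have b0 : 0 < b by lra.
have ca := is_cvg_series_ml_term t t0 lnt a a0.
have cb := is_cvg_series_ml_term t t0 lnt b b0.
set ua := series _ in ca *; set ub := series _ in cb *.
pose c := mean_drop (ml_term t) a b.
pose d k := c k.+1 - 2 * c k.+2 + c k.+3.
have d0 k : 0 < d k.
  apply: lt_le_trans (ml_term_second_difference t t0 lnt a b k a0 ab).
  have kb0 : 0 <= k.+3%:R * b by rewrite mulr_ge0// ltW.
  rewrite mulr_gt0 ?subr_gt0// mulr_gt0 ?exprn_gt0//.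
  by rewrite mulr_gt0 ?invr_gt0// ml_term_gt0.
have H m : d 0 <= ub m.+1.*2.+1 - ua m.+1.*2.+2.
  have -> : ub m.+1.*2.+1 - ua m.+1.*2.+2 =
    \sum_(0 <= k < m.+1.*2.+1) (-1) ^+ k.+1 * (k%:R * c k) +
      ml_term t (m.+1.*2.+1%:R * a).
    rewrite /ua [series _ m.+1.*2.+2]seriesSr opprD addrA; congr (_ + _).
      rewrite /ub /series /= -sumrB.
      apply: eq_bigr => k _; rewrite exprS mulN1r /c /mean_drop.
      have [->|k0] := eqVneq k 0%N; first by rewrite !mul0r subrr mulr0.
      by rewrite (mulrCA k%:R) divff ?pnatr_eq0//; ring.
    by rewrite exprS -signr_odd odd_double expr0; ring.
  rewrite alternating_sum_second_difference big_ord_recl /=.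
  have h1 : 0 <= \sum_(i < m) (bump 0 i).+1%:R * (c (bump 0 i).*2.+1
      - 2 * c (bump 0 i).*2.+2 + c (bump 0 i).*2.+3).
    by apply: sumr_ge0 => i _; rewrite mulr_ge0// ltW// d0.
  have h2 : m.+1%:R * c m.+1.*2.+1 <= ml_term t (m.+1.*2.+1%:R * a).
    rewrite /c /mean_drop.
    have fb : 0 < ml_term t (m.+1.*2.+1%:R * b) by rewrite ml_term_gt0// mulr_ge0// ltW.
    have fa : 0 < ml_term t (m.+1.*2.+1%:R * a) by rewrite ml_term_gt0// mulr_ge0// ltW.
    rewrite mulrA ler_pdivrMr ?ltr0n// [leRHS]mulrC.
    apply: (@le_trans _ _ (m.+1%:R * ml_term t (m.+1.*2.+1%:R * a))).
      by rewrite ler_pM2l ?ltr0n// lerBlDr lerDl ltW.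
    by rewrite ler_pM2r// ler_nat -addnn -addnS leq_addr.
  rewrite mul1r -[X in X + _ - _ + _]/(d 0%N); lra.
have dbl : (fun m => m.+1.*2.+1) @ \oo --> \oo.
  apply/cvgnyPge => A; exists A => // m /= Am; apply: leq_trans Am _.
  by rewrite doubleS -addnn -!addnS leq_addr.
have dbl' : (fun m => m.+1.*2.+2) @ \oo --> \oo.
  apply/cvgnyPge => A; exists A => // m /= Am; apply: leq_trans Am _.
  by rewrite doubleS -addnn -!addnS leq_addr.
have : d 0%N <= limn ub - limn ua.
  apply: (ler_cvg_to (cvg_cst (d 0%N)) (cvgB (cvg_comp _ _ dbl cb) (cvg_comp _ _ dbl' ca))).
  by apply: nearW => m; exact: H.
by rewrite -subr_gt0; apply: lt_le_trans; exact: d0.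
Qed.

End Comparison.

Theorem theorem3p5 (R : realType) (rho0 : R) (hrho0 : 0 < rho0 < 1) (t : R)
    (ht : 0 < t <= Num.min (1 / 2 `^ (1 / rho0)) (1 / expR (7 / 2))) :
  {in `[rho0, 1] &, {homo (fun rho : R => mittag_leffler rho (- t `^ rho)) :
    rho1 rho2 / rho1 < rho2}}.
Proof.
case/andP: hrho0 => r0 _; case/andP: ht => t0.
rewrite le_min => /andP[_ tl] a b; rewrite !in_itv/= => /andP[ra _] _.
apply: mittag_leffler_lt => //; last exact: lt_le_trans ra.
rewrite -(expRK (- (7 / 2))) ler_ln ?posrE ?expR_gt0//.
by rewrite expRN -div1r.
Qed.
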